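(* Let $k,m\in\frac12\mathbb{Z}$ and let $\omega$ be a multiplier system of weight $k$ (and index $m$) on $\Gamma(1)^J$ with $\omega([-I,(0,0)])=1$. Let $f:\mathcal{H}\times\mathbb{C}\to\mathbb{C}$ be a Jacobi integral of weight $k$ and index $m$ with multiplier system $\omega$ on $\Gamma(1)^J$, with period functions $P_\gamma$ ($\gamma\in\Gamma(1)^J$), satisfying $P_{[S,(0,0)]}=0$. Suppose $f$ is even and periodic with respect to $z$, i.e. $P_{[-I,(0,0)]}=0$ and $P_{[I,(0,1)]}=0$. Write $h:=P_{[I,(1,0)]}$. Then: (1) $P_{[T,(1,0)]}=P_{[T,(0,0)]}$; (2) $P_{[T,(0,0)]}+P_{[T,(0,0)]}|_{\omega,k,m}[T,(0,0)]=0$; (3) $P_{[T,(0,0)]}+P_{[T,(0,0)]}|_{\omega,k,m}[ST,(0,0)]+P_{[T,(0,0)]}|_{\omega,k,m}[(ST)^2,(0,0)]=0$; (4) $h|_{\omega,k,m}[T,(0,0)]=-P_{[T,(0,0)]}+P_{[T,(0,0)]}|_{\omega,k,m}[I,(0,-1)]$; (5) $h=P_{[T,(0,0)]}-P_{[T,(0,0)]}|_{\omega,k,m}[-I,(1,0)]$; (6) $h+h|_{\omega,k,m}[-I,(1,0)]=0$.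
   Context: $\mathcal{H}$ is the upper half plane; $\tau\in\mathcal{H}$, $z\in\mathbb{C}$, $v=\mathrm{Im}(\tau)$, $y=\mathrm{Im}(z)$. $S=\left(\begin{smallmatrix}1&1\\0&1\end{smallmatrix}\right)$, $T=\left(\begin{smallmatrix}0&-1\\1&0\end{smallmatrix}\right)$, $I$ is the $2\times2$ identity matrix. Jacobi group: $\Gamma(1)^J=\{[M,(\lambda,\mu)]: M\in SL_2(\mathbb{Z}),\ \lambda,\mu\in\mathbb{Z}\}$ with product $[M_1,(\lambda_1,\mu_1)][M_2,(\lambda_2,\mu_2)]=[M_1M_2,(\lambda_1,\mu_1)M_2+(\lambda_2,\mu_2)]$ (row vector times matrix). It acts on $\mathcal{H}\times\mathbb{C}$ by $\gamma(\tau,z)=\left(\frac{a\tau+b}{c\tau+d},\frac{z+\lambda\tau+\mu}{c\tau+d}\right)$ for $\gamma=[\left(\begin{smallmatrix}a&b\\c&d\end{smallmatrix}\right),(\lambda,\mu)]$. Automorphy factor: $j_{k,m}(\gamma,(\tau,z))=(c\tau+d)^{-k}\exp\left(2\pi i m\left(-\frac{c(z+\lambda\tau+\mu)^2}{c\tau+d}+\lambda^2\tau+2\lambda z+\lambda\mu\right)\right)$ (a fixed branch of the power is used). A multiplier system $\omega$ of weight $k$ (and index $m$) is a function $\omega:\Gamma(1)^J\to\mathbb{C}^*$ with $\omega(\gamma_1\gamma_2)j_{k,m}(\gamma_1\gamma_2,(\tau,z))=\omega(\gamma_1)\omega(\gamma_2)j_{k,m}(\gamma_1,\gamma_2(\tau,z))j_{k,m}(\gamma_2,(\tau,z))$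 for all $\gamma_1,\gamma_2$. Slash operator: $(f|_{\omega,k,m}\gamma)(\tau,z)=\omega(\gamma)j_{k,m}(\gamma,(\tau,z))f(\gamma(\tau,z))$. $\mathcal{P}_m$ is the space of functions $f$ holomorphic on $\mathcal{H}\times\mathbb{C}$ for which there are positive constants $K,\rho,\sigma$ with $|f(\tau,z)|<K(|\tau|^\rho+v^{-\sigma})e^{2\pi m y^2/v}$. A Jacobi integral of weight $k$, index $m$ and multiplier system $\omega$ on $\Gamma(1)^J$ is a real analytic function $f:\mathcal{H}\times\mathbb{C}\to\mathbb{C}$ such that: (i) for every $\gamma\in\Gamma(1)^J$, $f|_{\omega,k,m}\gamma=f+P_\gamma$ with $P_\gamma\in\mathcal{P}_m$ (the $P_\gamma$ are the period functions of $f$); (ii) $f$ is periodic: $P_{[I,(0,1)]}=0$ and $P_{[S^\ell,(0,0)]}=0$ for some $\ell\in\mathbb{Z}$; (iii) $|f(\tau,z)|v^{-k/2}e^{2\pi m y^2/v}\to0$ as $v,y\to\infty$. *)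

(* Defs.v *)
From HB Require Import structures.
From mathcomp Require Import all_boot all_order all_algebra.
From mathcomp Require Import complex.
From mathcomp Require Import all_classical all_reals all_analysis.

Set Implicit Arguments.
Unset Strict Implicit.
Unset Printing Implicit Defensive.

Import Order.TTheory GRing.Theory Num.Theory.
Import numFieldNormedType.Exports.

Local Open Scope ring_scope.
Local Open Scope complex_scope.
Local Open Scope classical_set_scope.

Record SL2Z := MkSL2Z { SL2Z_mx :> 'M[int]_2; _ : \det SL2Z_mx == 1 }.

HB.instance Definition _ := [isSub for SL2Z_mx].
HB.instance Definition _ := [Choice of SL2Z by <:].

Lemma SL2Z_det (M : SL2Z) : \det M = 1.
Proof. by case: M => M /= /eqP. Qed.

Lemma SL2Z_unit (M : SL2Z) : (M : 'M[int]_2) \in unitmx.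
Proof. by rewrite unitmxE SL2Z_det unitr1. Qed.

Fact SL2Z_one_subproof : \det (1%:M : 'M[int]_2) == 1.
Proof. by rewrite det1. Qed.

Fact SL2Z_mul_subproof (M N : SL2Z) : \det (M *m N) == 1.
Proof. by rewrite det_mulmx !SL2Z_det mulr1. Qed.

Fact SL2Z_inv_subproof (M : SL2Z) : \det (invmx M) == 1.
Proof. by rewrite det_inv SL2Z_det invr1. Qed.

Definition SL2Z_one := MkSL2Z SL2Z_one_subproof.
Definition SL2Z_mul M N := MkSL2Z (SL2Z_mul_subproof M N).
Definition SL2Z_inv M := MkSL2Z (SL2Z_inv_subproof M).

Fact SL2Z_mulA : associative SL2Z_mul.
Proof. by move=> L M N; apply: val_inj; exact: mulmxA. Qed.
Fact SL2Z_mul1 : left_id SL2Z_one SL2Z_mul.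
Proof. by move=> M; apply: val_inj; exact: mul1mx. Qed.
Fact SL2Z_mulr1 : right_id SL2Z_one SL2Z_mul.
Proof. by move=> M; apply: val_inj; exact: mulmx1. Qed.
Fact SL2Z_mulV : left_inverse SL2Z_one SL2Z_inv SL2Z_mul.
Proof. by move=> M; apply: val_inj; exact/mulVmx/SL2Z_unit. Qed.
Fact SL2Z_mulrV : right_inverse SL2Z_one SL2Z_inv SL2Z_mul.
Proof. by move=> M; apply: val_inj; exact/mulmxV/SL2Z_unit. Qed.

HB.instance Definition _ := isGroup.Build SL2Z
  SL2Z_mulA SL2Z_mul1 SL2Z_mulr1 SL2Z_mulV SL2Z_mulrV.

Definition mx2 (a b c d : int) : 'M[int]_2 :=
  \matrix_(i, j) nth 0 (nth [::] [:: [:: a; b]; [:: c; d]] i) j.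

Lemma det_mx2 a b c d : \det (mx2 a b c d) = a * d - b * c.
Proof.
rewrite (expand_det_row _ ord0) !big_ord_recl big_ord0 /cofactor !det_mx11.
by rewrite !mxE /= addr0 expr0 expr1 mul1r mulN1r mulrN.
Qed.

Fact SL2Z_S_subproof : \det (mx2 1 1 0 1) == 1.
Proof. by rewrite det_mx2. Qed.

Fact SL2Z_T_subproof : \det (mx2 0 (-1) 1 0) == 1.
Proof. by rewrite det_mx2. Qed.

Fact SL2Z_N_subproof : \det (- 1%:M : 'M[int]_2) == 1.
Proof. by rewrite -scaleN1r detZ det1. Qed.

Definition matS : SL2Z := MkSL2Z SL2Z_S_subproof.
Definition matT : SL2Z := MkSL2Z SL2Z_T_subproof.
Definition matI : SL2Z := 1%g.
Definition matN : SL2Z := MkSL2Z SL2Z_N_subproof.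

Definition expgz (G : groupType) (g : G) (l : int) : G :=
  match l with Posz n => (g ^+ n)%g | Negz n => (g ^- n.+1)%g end.

Record jacobi := Jacobi { jmat : SL2Z; jvec : 'rV[int]_2 }.

Definition jacobi_pair (g : jacobi) := (jmat g, jvec g).
Fact jacobi_pairK : cancel jacobi_pair (fun p => Jacobi p.1 p.2).
Proof. by case. Qed.
HB.instance Definition _ := Choice.copy jacobi (can_type jacobi_pairK).

Definition jacobi_one := Jacobi 1%g 0.
Definition jacobi_mul (g1 g2 : jacobi) :=
  Jacobi (jmat g1 * jmat g2)%g (jvec g1 *m jmat g2 + jvec g2).
Definition jacobi_inv (g : jacobi) :=
  Jacobi (jmat g)^-1%g (- (jvec g *m (jmat g)^-1%g)).

Fact jacobi_mulA : associative jacobi_mul.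
Proof.
move=> [L x] [M y] [N z]; rewrite /jacobi_mul /= mulgA.
by rewrite mulmxDl -mulmxA addrA.
Qed.
Fact jacobi_mul1 : left_id jacobi_one jacobi_mul.
Proof. by move=> [M x]; rewrite /jacobi_mul /= mul1g mul0mx add0r. Qed.
Fact jacobi_mulr1 : right_id jacobi_one jacobi_mul.
Proof. by move=> [M x]; rewrite /jacobi_mul /= mulg1 mulmx1 addr0. Qed.
Fact jacobi_mulV : left_inverse jacobi_one jacobi_inv jacobi_mul.
Proof.
move=> [M x]; rewrite /jacobi_mul /= mulVg mulNmx -mulmxA.
by rewrite mulVmx ?SL2Z_unit// mulmx1 addNr.
Qed.
Fact jacobi_mulrV : right_inverse jacobi_one jacobi_inv jacobi_mul.
Proof. by move=> [M x]; rewrite /jacobi_mul /= mulgV subrr. Qed.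

HB.instance Definition _ := isGroup.Build jacobi
  jacobi_mulA jacobi_mul1 jacobi_mulr1 jacobi_mulV jacobi_mulrV.

Definition jac (M : SL2Z) (lambda mu : int) : jacobi :=
  Jacobi M (\row_(j < 2) [:: lambda; mu]`_j).

Section Complex.
Variable R : realType.
Local Notation C := R[i].

Definition cexp (z : C) : C :=
  (expR (complex.Re z))%:C * (cos (complex.Im z) +i* sin (complex.Im z)).

(* A branch of the logarithm on C^*, continuous on the upper and on the lower
   half plane; its values on the real axis are only required to be logarithms.
   This makes (c tau + d)^s holomorphic in tau for all real c, d not both 0. *)
Definition log_branch (clog : C -> C) : Prop :=
  (forall w : C, w != 0 -> cexp (clog w) = w) /\
  (forall w : C, complex.Im w != 0 -> {for w, continuous (clog : C^o -> C^o)}).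

Definition HC : {pred C * C} := fun p => 0 < complex.Im p.1.

Definition holomorphic_on_HC (f : C * C -> C) : Prop :=
  forall p, p \in HC -> differentiable (f : C^o * C^o -> C^o) (p : C^o * C^o).

(* [g] is, near [x0], the sum of an absolutely convergent power series
   in n real variables with complex coefficients [a]; the sum is computed along
   the boxes [0, N[^n of multi-indices. *)
Definition analytic_at n (g : 'rV[R]_n -> C) (x0 : 'rV[R]_n) : Prop :=
  exists (a : {ffun 'I_n -> nat} -> C) (r : R), 0 < r /\
  forall x : 'rV[R]_n, (forall i, `|x 0 i - x0 0 i| < r) ->
    let t (e : {ffun 'I_n -> nat}) :=
      a e * (\prod_(i < n) (x 0 i - x0 0 i) ^+ e i)%:C in
    (\esum_(e in [set: {ffun 'I_n -> nat}]) (Normc.normc (t e))%:E < +oo)%E /\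
    ((fun N => \sum_(e : {ffun 'I_n -> 'I_N}) t [ffun i => val (e i)])
       : nat -> C^o)
      @ \oo --> (g x : C^o).

Definition point_of_coords (x : 'rV[R]_4) : C * C :=
  (x 0 0 +i* x 0 1, x 0 2 +i* x 0 3).

Definition real_analytic_on_HC (f : C * C -> C) : Prop :=
  forall x, point_of_coords x \in HC -> analytic_at (f \o point_of_coords) x.

Section Weight.
Variables (clog : C -> C) (k m : R).

Definition cpow (w : C) (s : R) : C := cexp (s%:C * clog w).

Definition jacobi_act (g : jacobi) (p : C * C) : C * C :=
  let: (tau, z) := p in
  let a := (jmat g 0 0)%:~R in let b := (jmat g 0 1)%:~R in
  let c := (jmat g 1 0)%:~R in let d := (jmat g 1 1)%:~R in
  let lambda := (jvec g 0 0)%:~R in let mu := (jvec g 0 1)%:~R in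
  ((a * tau + b) / (c * tau + d), (z + lambda * tau + mu) / (c * tau + d)).

Definition automorphy (g : jacobi) (p : C * C) : C :=
  let: (tau, z) := p in
  let c := (jmat g 1 0)%:~R in let d := (jmat g 1 1)%:~R in
  let lambda := (jvec g 0 0)%:~R in let mu := (jvec g 0 1)%:~R in
  cpow (c * tau + d) (- k) *
  cexp ((2 * pi * m)%:C * 'i *
        (- (c * (z + lambda * tau + mu) ^+ 2 / (c * tau + d))
         + lambda ^+ 2 * tau + 2 * lambda * z + lambda * mu)).

Definition multiplier_system (omega : jacobi -> C) : Prop :=
  (forall g, omega g != 0) /\
  (forall g1 g2 p, p \in HC ->
    omega (g1 * g2)%g * automorphy (g1 * g2)%g p =
    omega g1 * omega g2 * automorphy g1 (jacobi_act g2 p) * automorphy g2 p).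

Definition slash (omega : jacobi -> C) (f : C * C -> C) (g : jacobi) :
    C * C -> C :=
  fun p => omega g * automorphy g p * f (jacobi_act g p).

Definition growth_space (f : C * C -> C) : Prop :=
  holomorphic_on_HC f /\
  exists K rho sigma : R, [/\ 0 < K, 0 < rho, 0 < sigma &
    forall p, p \in HC ->
      let v := complex.Im p.1 in let y := complex.Im p.2 in
      Normc.normc (f p) <
        K * (Normc.normc p.1 `^ rho + v `^ (- sigma))
          * expR (2 * pi * m * y ^+ 2 / v)].

(* [f] is a Jacobi integral whose family of period functions is [P]. Functions
   on H x C are represented by functions on C * C whose values outside [HC]
   are irrelevant. The limit as v, y -> +oo is uniform in Re tau and Re z. *)
Record jacobi_integral (omega : jacobi -> C) (f : C * C -> C)
    (P : jacobi -> C * C -> C) : Prop := {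
  jacobi_integral_analytic : real_analytic_on_HC f;
  jacobi_integral_period : forall g,
    {in HC, slash omega f g =1 f \+ P g} /\ growth_space (P g);
  jacobi_integral_periodic :
    {in HC, P (jac matI 0 1) =1 cst 0} /\
    (exists l : int, {in HC, P (jac (expgz matS l) 0 0) =1 cst 0});
  jacobi_integral_limit : forall eps : R, 0 < eps ->
    exists B : R, forall p, p \in HC ->
      let v := complex.Im p.1 in let y := complex.Im p.2 in
      B < v -> B < y ->
      Normc.normc (f p) * v `^ (- (k / 2)) * expR (2 * pi * m * y ^+ 2 / v)
        < eps }.

End Weight.
End Complex.

(* Main.v *)
(* The slash operator is a right action of the Jacobi group on functions on
   H x C, so the period functions satisfy the cocycle relation
   P_(g1 g2) = P_g1 | g2 + P_g2.  Each identity comes from writing one group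
   element as a product in two ways: T^2 = (ST)^3 = -I for (2) and (3),
   [I,(1,0)] T = T [I,(0,-1)] for (4), and
   [I,(0,-1)] (-T) = T [-I,(1,0)] for (5). *)

Require Import Defs.
From HB Require Import structures.
From mathcomp Require Import all_boot all_order all_algebra.
From mathcomp Require Import ring complex.
From mathcomp Require Import all_classical all_reals all_analysis.

Set Implicit Arguments.
Unset Strict Implicit.
Unset Printing Implicit Defensive.

Import Order.TTheory GRing.Theory Num.Theory.
Import numFieldNormedType.Exports.

Local Open Scope ring_scope.

(* Keeps 0 and 1 in the last two arguments integers under %g. *)
Arguments jac M (lambda mu)%_ring_scope.

Lemma SL2Z_detE (M : SL2Z) : M 0 0 * M 1 1 - M 0 1 * M 1 0 = 1.
Proof.
have lift01 : lift ord0 ord0 = 1 :> 'I_2 by apply/val_inj.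
have lift10 : lift 1 ord0 = 0 :> 'I_2 by apply/val_inj.
rewrite -(SL2Z_det M) (expand_det_row _ 0) !big_ord_recl big_ord0 /cofactor.
by rewrite !det_mx11 !mxE /= lift01 lift10 addr0 expr0 expr1 mul1r mulN1r mulrN.
Qed.

Lemma mx2M a b c d a' b' c' d' : mx2 a b c d *m mx2 a' b' c' d' =
  mx2 (a * a' + b * c') (a * b' + b * d') (c * a' + d * c') (c * b' + d * d').
Proof.
apply/matrixP => -[[|[|//]] i] -[[|[|//]] j];
by rewrite !mxE !big_ord_recl big_ord0 !mxE /= addr0.
Qed.

Lemma matNE : SL2Z_mx matN = mx2 (-1) 0 0 (-1).
Proof. by apply/matrixP => -[[|[|//]] i] -[[|[|//]] j]; rewrite !mxE. Qed.

Lemma matTT : (matT * matT)%g = matN.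
Proof. by apply: val_inj; rewrite [RHS]matNE /= mx2M. Qed.

Lemma matNN : (matN * matN)%g = matI.
Proof. by apply: val_inj; rewrite /= mulNmx mulmxN mulmx1 opprK. Qed.

Lemma matNC M : (matN * M)%g = (M * matN)%g.
Proof. by apply: val_inj; rewrite /= mulNmx mulmxN mulmx1 mul1mx. Qed.

(** The product ST has trace 1 and determinant 1, so (ST)^2 = ST - I and hence (ST)^3 = -I. *)
Lemma matST_cube : ((matS * matT) ^+ 3)%g = matN.
Proof. by apply: val_inj; rewrite [RHS]matNE /= !mx2M. Qed.

Lemma jacM M N l u l' u' : (jac M l u * jac N l' u')%g =
  jac (M * N)%g (l * N 0 0 + u * N 1 0 + l') (l * N 0 1 + u * N 1 1 + u').
Proof.
congr Jacobi; apply/matrixP => i -[[|[|//]] j];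
rewrite !mxE !big_ord_recl big_ord0 !mxE /= addr0;
by congr (_ * fun_of_matrix N _ _ + _ * fun_of_matrix N _ _ + _);
  apply: val_inj.
Qed.

Lemma jac0M M N l u : (jac M 0 0 * jac N l u)%g = jac (M * N)%g l u.
Proof. by rewrite jacM !mul0r !add0r. Qed.

Lemma jacM0 M N l u : (jac M l u * jac N 0 0)%g =
  jac (M * N)%g (l * N 0 0 + u * N 1 0) (l * N 0 1 + u * N 1 1).
Proof. by rewrite jacM !addr0. Qed.

Lemma jacIM N l u : (jac 1%g l u * jac N 0 0)%g =
  (jac N 0 0 *
   jac 1 (l * N 0 0 + u * N 1 0)%R (l * N 0 1 + u * N 1 1)%R)%g.
Proof. by rewrite jacM0 jac0M mul1g mulg1. Qed.

Section MoebiusAction.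
Variable R : realType.
Local Notation C := R[i].

Let intC (n : int) : (n%:~R : C) = (n%:~R : R)%:C%C.
Proof. by rewrite rmorph_int. Qed.

Lemma Im_div (z w : C) : complex.Im (z / w) =
  (complex.Im z * complex.Re w - complex.Re z * complex.Im w)
    / (complex.Re w ^+ 2 + complex.Im w ^+ 2).
Proof. by case: z w => [a b] [c d] /=; rewrite mulrBl; ring. Qed.

(** A zero would give c v = 0, so c = 0, and then d = 0, contradicting ad - bc = 1. *)
Lemma SL2Z_den_neq0 (M : SL2Z) (tau : C) : 0 < complex.Im tau ->
  (M 1 0)%:~R * tau + (M 1 1)%:~R != 0.
Proof.
move=> v_gt0; apply/negP => /eqP; rewrite !intC.
case: tau v_gt0 => x v /= v_gt0 [].
rewrite !mul0r subr0 !addr0 => cx /eqP.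
rewrite mulf_eq0 (gt_eqF v_gt0) orbF intr_eq0 => /eqP c0.
move: cx; rewrite c0 mul0r add0r => /eqP; rewrite intr_eq0 => /eqP d0.
by have := SL2Z_detE M; rewrite c0 d0 !mulr0 subrr.
Qed.

(** The new imaginary part is (ad - bc) v / |c tau + d|^2 = v / |c tau + d|^2. *)
Lemma jacobi_act_HC (g : jacobi) (p : C * C) :
  p \in @HC R -> jacobi_act g p \in @HC R.
Proof.
case: p => tau z; rewrite !unfold_in /= => v_gt0.
have den0 := SL2Z_den_neq0 (jmat g) v_gt0.
rewrite Im_div; move: den0; have := SL2Z_detE (jmat g).
move/(congr1 (fun n : int => n%:~R : R)).
rewrite !intC rmorphB !rmorphM /=.
case: tau v_gt0 => x v /= v_gt0 detE den0; rewrite divr_gt0//.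
  rewrite [ltRHS](_ : _ = v * 1%:~R); first by rewrite mulr1.
  by rewrite -detE; ring.
rewrite lt0r addr_ge0 ?sqr_ge0// andbT paddr_eq0 ?sqr_ge0// !sqrf_eq0.
by rewrite eq_complex /= !mul0r !addr0 subr0 in den0 *.
Qed.

Lemma jacobi_actM (g1 g2 : jacobi) (p : C * C) : p \in @HC R ->
  jacobi_act (g1 * g2)%g p = jacobi_act g1 (jacobi_act g2 p).
Proof.
move=> pH; have := jacobi_act_HC g2 pH.
case: p pH => tau z; rewrite !unfold_in /=.
move=> /(SL2Z_den_neq0 (jmat g2)) den2 /(SL2Z_den_neq0 (jmat g1)) den1.
rewrite !mxE !big_ord_recl !big_ord0.
have -> : lift ord0 ord0 = 1 :> 'I_2 by apply/val_inj.
rewrite !addr0 -[ord0]/(0 : 'I_2) !rmorphD !rmorphM /=.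
(* The denominator of the product is the denominator of [g1] at the image point times that of [g2];
   once it is nonzero, both coordinates are identities of rational functions. *)
have den12 := mulf_neq0 den1 den2; rewrite mulrDl mulrA divfK// in den12.
by congr (_, _); field; rewrite den2.
Qed.

Variables (clog : C -> C) (k m : R) (omega : jacobi -> C).
Hypothesis omega_mult : multiplier_system clog k m omega.
Local Notation sl := (slash clog k m omega).

Lemma slashM f g1 g2 : {in @HC R, sl f (g1 * g2)%g =1 sl (sl f g1) g2}.
Proof.
move=> p pH; rewrite /slash jacobi_actM// (omega_mult.2 _ _ _ pH); ring.
Qed.

Lemma slashD f1 f2 g : sl (f1 \+ f2) g =1 sl f1 g \+ sl f2 g.
Proof. by move=> p; rewrite /slash /= mulrDr. Qed.

(** The action preserves H x C, so values outside [HC] never enter. *)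
Lemma slash_eq f1 f2 g :
  {in @HC R, f1 =1 f2} -> {in @HC R, sl f1 g =1 sl f2 g}.
Proof. by move=> eqf p pH; rewrite /slash eqf// jacobi_act_HC. Qed.

Lemma slash0 f g :
  {in @HC R, f =1 cst 0} -> {in @HC R, sl f g =1 cst 0}.
Proof. by move=> f0 p pH; rewrite (slash_eq _ f0)// /slash mulr0. Qed.

(** Expand f|(g1 g2) = (f + P_g1)|g2 = f + P_g2 + P_g1|g2 and cancel f. *)
Lemma period_cocycle f P g1 g2 : jacobi_integral clog k m omega f P ->
  {in @HC R, P (g1 * g2)%g =1 sl (P g1) g2 \+ P g2}.
Proof.
move=> /jacobi_integral_period fP p pH.
apply: (addrI (f p)); rewrite -[LHS]((fP _).1 p pH) slashM//.
rewrite (slash_eq _ (fP g1).1)// slashD /= addrCA addrC; congr (_ + _).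
exact: (fP g2).1.
Qed.

End MoebiusAction.

Theorem theorem4p6 (R : realType) (clog : R[i] -> R[i]) (k m : R)
    (omega : jacobi -> R[i]) (f : R[i] * R[i] -> R[i])
    (P : jacobi -> R[i] * R[i] -> R[i])
    (clog_branch : log_branch clog)
    (k_half : k *+ 2 \is a Num.int) (m_half : m *+ 2 \is a Num.int)
    (omega_mult : multiplier_system clog k m omega)
    (omegaN : omega (jac matN 0 0) = 1)
    (f_integral : jacobi_integral clog k m omega f P)
    (P_S : {in @HC R, P (jac matS 0 0) =1 cst 0})
    (P_even : {in @HC R, P (jac matN 0 0) =1 cst 0})
    (P_periodic : {in @HC R, P (jac matI 0 1) =1 cst 0}) :
  let PT := P (jac matT 0 0) in
  let h := P (jac matI 1 0) in
  let sl := slash clog k m omega in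
  let ST := (matS * matT)%g in
  {in @HC R, P (jac matT 1 0) =1 PT} /\
  {in @HC R, PT \+ sl PT (jac matT 0 0) =1 cst 0} /\
  {in @HC R, PT \+ sl PT (jac ST 0 0) \+ sl PT (jac (ST ^+ 2)%g 0 0)
             =1 cst 0} /\
  {in @HC R, sl h (jac matT 0 0) =1 \- PT \+ sl PT (jac matI 0 (-1))} /\
  {in @HC R, h =1 PT \- sl PT (jac matN 1 0)} /\
  {in @HC R, h \+ sl h (jac matN 1 0) =1 cst 0}.
Proof.
move=> PT h sl ST.
have cocycle g1 g2 p : p \in @HC R -> P (g1 * g2)%g p = sl (P g1) g2 p + P g2 p.
  exact: (period_cocycle omega_mult g1 g2 f_integral).
have sl0 Q g p : {in @HC R, Q =1 cst 0} -> p \in @HC R -> sl Q g p = 0.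
  by move=> Q0 pH; exact: (slash0 clog k m omega g Q0 pH).
(* Use I = (-I)^2 and evenness. *)
have P1 : {in @HC R, P (jac matI 0 0) =1 cst 0}.
  by move=> p pH; rewrite -matNN -jac0M cocycle// sl0// P_even// addr0.
have P_periodicV : {in @HC R, P (jac matI 0 (-1)) =1 cst 0}.
  move=> p pH; have := P1 p pH.
  rewrite -[jac matI 0 0](_ : jac matI 0 1 * jac matI 0 (-1) = _)%g.
    by rewrite cocycle// sl0// add0r.
  by rewrite jacM !mxE /= mulg1.
have P_N1 : {in @HC R, P (jac matN 1 0) =1 h}.
  by move=> p pH; rewrite -[matN]mulg1 -jac0M cocycle// sl0// add0r.
(* Since P_S = 0, a left factor S is invisible to the periods; this lets (3) be stated with P_T
   alone. *)
have P_ST p : p \in @HC R -> P (jac ST 0 0) p = PT p.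
  by move=> pH; rewrite -jac0M cocycle// sl0// add0r.
have sl_ST g p : p \in @HC R -> sl (P (jac ST 0 0)) g p = sl PT g p.
  by move=> pH; apply: slash_eq => // q qH; exact: P_ST.
have jacIT : (jac matI 1 0 * jac matT 0 0 = jac matT 0 0 * jac matI 0 (-1))%g.
  by rewrite jacIM !mxE.
split=> [p pH|].
  (* Here (0,1)T = (1,0), and the left factor [I,(0,1)] has zero period. *)
  have -> : jac matT 1 0 = (jac matI 0 1 * jac matT 0 0)%g.
    by rewrite jacM0 !mxE /= mul1g.
  by rewrite cocycle// sl0// add0r.
split=> [p pH|].
  by rewrite /= addrC -cocycle// jac0M matTT P_even.
split=> [p pH|].
  (* Peel one factor ST off the left of (ST)^3, then of (ST)^2; each contributes a slashed copy of
     P_T. *)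
  have := P_even p pH; rewrite -matST_cube expgS -jac0M cocycle// sl_ST//.
  rewrite expgS expg1 -jac0M cocycle// sl_ST// P_ST//= => <-.
  by rewrite addrC [PT p + _]addrC.
split=> [p pH|].
  have := cocycle (jac matI 1 0) (jac matT 0 0) p pH.
  by rewrite jacIT cocycle// P_periodicV// addr0 /= => ->; rewrite addrC addrK.
(* The period of [-T,(1,0)] is computed twice. The factorization [I,(0,-1)][-I,(0,0)][T,(0,0)] gives
   just P_T, as the first two factors have zero period; it rests on (0,-1)(-T) = (1,0). *)
have P_TN1 p : p \in @HC R -> PT p = sl PT (jac matN 1 0) p + h p.
  move=> pH; rewrite -P_N1// -cocycle// jac0M.
  have -> : jac (matT * matN)%g 1 0 =
      (jac matI 0 (-1) * (jac matN 0 0 * jac matT 0 0))%g.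
    rewrite jac0M jacM0 mul1g matNC; congr jac;
    by rewrite /= mulmxN mulmx1 !mxE.
  by rewrite cocycle// sl0// add0r cocycle// sl0// add0r.
split=> p pH.
  by rewrite /= [PT p]P_TN1// addrC addKr.
(* The element [-I,(1,0)] has period h and is an involution, because (1,0)(-I) + (1,0) = 0; the
   cocycle relation for its square then gives P_I = 0 on the right. *)
rewrite /= -[sl h _ _](_ : sl (P (jac matN 1 0)) (jac matN 1 0) p = _);
  last exact: slash_eq.
rewrite addrC -P_N1// -cocycle//.
rewrite jacM matNN -[RHS](P1 p pH); congr (P (jac _ _ _) _);
by rewrite /= !mxE.
Qed.
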